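(* Let $\mathsf a=(\mathsf a_{\ell,\ell'})_{\ell,\ell'\ge0}$, $\mathsf b=(\mathsf b_{\ell,\ell'})_{\ell,\ell'\ge0}$, $\mathsf c=(\mathsf c_{\ell,\ell'})_{\ell,\ell'\ge0}$, $\mathsf d=(\mathsf d_{\ell,\ell'})_{\ell,\ell'\ge0}$, $\mathsf e=(\mathsf e_\ell)_{\ell\ge0}$ be indeterminates, and for $n\ge0$ define $$\begin{aligned}Q_n(\mathsf a,\mathsf b,\mathsf c,\mathsf d,\mathsf e)=\sum_{\sigma\in\mathfrak S_n}\;&\prod_{i\in\mathrm{cval}}\mathsf a_{\mathrm{ucross}(i,\sigma),\,\mathrm{unest}(i,\sigma)}\prod_{i\in\mathrm{cpeak}}\mathsf b_{\mathrm{lcross}(i,\sigma),\,\mathrm{lnest}(i,\sigma)}\\&\times\prod_{i\in\mathrm{cdfall}}\mathsf c_{\mathrm{lcross}(i,\sigma),\,\mathrm{lnest}(i,\sigma)}\prod_{i\in\mathrm{cdrise}}\mathsf d_{\mathrm{ucross}(i,\sigma),\,\mathrm{unest}(i,\sigma)}\prod_{i\in\mathrm{fix}}\mathsf e_{\mathrm{lev}(i,\sigma)}.\end{aligned}$$ Then $$\sum_{n=0}^\infty Q_n(\mathsf a,\mathsf b,\mathsf c,\mathsf d,\mathsf e)\,t^n=\cfrac{1}{1-\gamma_0 t-\cfrac{\beta_1t^2}{1-\gamma_1t-\cfrac{\beta_2t^2}{1-\gamma_2 t-\cdots}}}$$ with coefficients $$\gamma_n=\mathsf c^\star_{n-1}+\mathsf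 d^\star_{n-1}+\mathsf e_n\quad(n\ge0),\qquad \beta_n=\mathsf a^\star_{n-1}\,\mathsf b^\star_{n-1}\quad(n\ge1),$$ where $\mathsf a^\star_{n-1}=\sum_{\ell=0}^{n-1}\mathsf a_{\ell,n-1-\ell}$ and likewise for $\mathsf b,\mathsf c,\mathsf d$ (so that $\mathsf c^\star_{-1}=\mathsf d^\star_{-1}=0$).
   Context: $\mathfrak S_n$ is the set of permutations of $[n]=\{1,\dots,n\}$. Continued fractions are identities of formal power series in $t$. For $\sigma\in\mathfrak S_n$, an index $i\in[n]$ is a cycle peak (cpeak) if $\sigma^{-1}(i)<i>\sigma(i)$; a cycle valley (cval) if $\sigma^{-1}(i)>i<\sigma(i)$; a cycle double rise (cdrise) if $\sigma^{-1}(i)<i<\sigma(i)$; a cycle double fall (cdfall) if $\sigma^{-1}(i)>i>\sigma(i)$; a fixed point (fix) if $\sigma(i)=i$. Products over $i\in\mathrm{cval}$ etc. run over the indices of $\sigma$ of that type. Index-refined statistics (quadruplets and triplets in $[n]$): $\mathrm{ucross}(j,\sigma)=\#\{i<j<k<l:\ k=\sigma(i),\ l=\sigma(j)\}$, $\mathrm{unest}(j,\sigma)=\#\{i<j<k<l:\ k=\sigma(j),\ l=\sigma(i)\}$, $\mathrm{lcross}(k,\sigma)=\#\{i<j<k<l:\ i=\sigma(k),\ j=\sigma(l)\}$, $\mathrm{lnest}(k,\sigma)=\#\{i<j<k<l:\ i=\sigma(l),\ j=\sigma(k)\}$ (in the first two the index $j$ is fixed and one counts triples $(i,k,l)$; in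 the last two $k$ is fixed and one counts triples $(i,j,l)$). For a fixed point $j$, $\mathrm{lev}(j,\sigma)=\#\{i<j:\sigma(i)>j\}=\#\{l>j:\sigma(l)<j\}$. *)

(* Defs.v *)
From HB Require Import structures.
From mathcomp Require Import all_boot all_order all_algebra all_fingroup.

Set Implicit Arguments.
Unset Strict Implicit.
Unset Printing Implicit Defensive.

Import GRing.Theory.
Local Open Scope ring_scope.

(* A formal power series in t over R is its coefficient sequence; two series  *)
(* are identified when they agree coefficientwise.                            *)
Notation fps R := (nat -> R) (only parsing).

Section FormalPowerSeries.
Variable R : comNzRingType.
Implicit Types (f g u : fps R) (m n k : nat).

Definition fps_sub f g : fps R := fun n => f n - g n.
Definition fps_mul f g : fps R :=
  fun n => \sum_(i < n.+1) f i * g (n - i)%N.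
Definition fps_monom (x : R) k : fps R := fun n => if n == k then x else 0.
Definition fps_one : fps R := fps_monom 1 0.
Definition fps_exp f k : fps R := iter k (fps_mul f) fps_one.

(* The multiplicative inverse of a series f with constant term 1, as the      *)
(* geometric series 1 + u + u^2 + ... with u = 1 - f; as u has no constant    *)
(* term, u^k does not contribute to the coefficient of t^n when k > n.        *)
Definition fps_inv f : fps R :=
  fun n => \sum_(k < n.+1) fps_exp (fps_sub fps_one f) k n.

Lemma fps_exp_small u k n : u 0%N = 0 -> (n < k)%N -> fps_exp u k n = 0.
Proof.
move=> u0; elim: k n => [//|k IHk] n ltnk.
rewrite /fps_exp iterS -/(fps_exp u k) /fps_mul big_ord_recl u0 mul0r add0r.
apply: big1 => i _; rewrite IHk ?mulr0 //= /bump /=.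
have := ltn_ord i; case: n ltnk i => [|n] ltnk i lti //.
by rewrite add1n subSS (leq_ltn_trans (leq_subr _ _)).
Qed.

Lemma fps_invP f : f 0%N = 1 -> forall n, fps_mul f (fps_inv f) n = fps_one n.
Proof.
move=> f0 n; set u := fps_sub fps_one f.
have u0 : u 0%N = 0 by rewrite /u /fps_sub /fps_one /fps_monom /= f0 subrr.
have invE m : (m <= n)%N -> fps_inv f m = \sum_(k < n.+1) fps_exp u k m.
  move=> lemn; rewrite /fps_inv -/u -!(big_mkord xpredT (fun k => fps_exp u k m)).
  rewrite (big_cat_nat (n := m.+1) (p := n.+1)) //=.
  rewrite -[LHS]addr0; congr (_ + _).
  rewrite big_nat big1 // => k /andP[ltmk _].
  exact: fps_exp_small.
transitivity (\sum_(k < n.+1) (fps_exp u k n - fps_exp u k.+1 n)).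
  rewrite /fps_mul.
  under eq_bigr => i _ do rewrite (invE _ (leq_subr _ _)) mulr_sumr.
  rewrite exchange_big; apply: eq_bigr => k _.
  rewrite [fps_exp u k.+1]iterS -/(fps_exp u k) /fps_mul.
  have -> : fps_exp u k n = \sum_(i < n.+1) fps_one i * fps_exp u k (n - i).
    rewrite big_ord_recl mul1r subn0 big1 ?addr0 // => i _.
    by rewrite /fps_one /fps_monom mul0r.
  rewrite -sumrB; apply: eq_bigr => i _.
  by rewrite -mulrBl /u /fps_sub subKr.
rewrite -(big_mkord xpredT (fun k => fps_exp u k n - fps_exp u k.+1 n)).
under eq_bigr => k _ do rewrite -opprB.
rewrite sumrN (telescope_sumr (fun k => fps_exp u k n)) // opprB.
by rewrite (@fps_exp_small u n.+1) ?subr0.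
Qed.

(* t-adic convergence of a sequence of formal power series *)
Definition fps_cvg (F : nat -> fps R) f :=
  forall n, exists K, forall k, (K <= k)%N -> F k n = f n.

(* jconvergent gamma beta k m is the finite continued fraction with k levels  *)
(*   1/(1 - gamma_m t - beta_{m+1} t^2/(1 - gamma_{m+1} t - ...               *)
(*      ... /(1 - gamma_{m+k-1} t)))                                          *)
(* and 0 when k = 0. The value beta_0 is never used.                          *)
Fixpoint jconvergent (gamma beta : nat -> R) (k m : nat) : fps R :=
  if k is k'.+1 then
    fps_inv
      (fps_sub (fps_sub fps_one (fps_monom (gamma m) 1))
         (fps_mul (fps_monom (beta m.+1) 2) (jconvergent gamma beta k' m.+1)))
  else fun=> 0.

(* f is the infinite J-fraction, i.e. the t-adic limit of its convergents *)
Definition is_Jfraction f (gamma beta : nat -> R) :=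
  fps_cvg (fun k => jconvergent gamma beta k 0) f.

End FormalPowerSeries.

(* [n] is modelled by 'I_n, i.e. shifted to {0, ..., n-1}; all the notions    *)
(* below depend only on the order of the indices.                             *)
Section PermutationStatistics.
Variable n : nat.
Implicit Types (s : 'S_n) (i j k l : 'I_n).

Definition cpeak s i := (s^-1%g i < i)%N && (s i < i)%N.
Definition cval s i := (i < s^-1%g i)%N && (i < s i)%N.
Definition cdrise s i := (s^-1%g i < i)%N && (i < s i)%N.
Definition cdfall s i := (i < s^-1%g i)%N && (s i < i)%N.
Definition fixpt s i := s i == i.

Definition ucross j s : nat :=
  #|[set p : 'I_n * 'I_n * 'I_n | let: (i, k, l) := p in
      [&& (i < j)%N, (j < k)%N, (k < l)%N, k == s i & l == s j]]|.

Definition unest j s : nat :=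
  #|[set p : 'I_n * 'I_n * 'I_n | let: (i, k, l) := p in
      [&& (i < j)%N, (j < k)%N, (k < l)%N, k == s j & l == s i]]|.

Definition lcross k s : nat :=
  #|[set p : 'I_n * 'I_n * 'I_n | let: (i, j, l) := p in
      [&& (i < j)%N, (j < k)%N, (k < l)%N, i == s k & j == s l]]|.

Definition lnest k s : nat :=
  #|[set p : 'I_n * 'I_n * 'I_n | let: (i, j, l) := p in
      [&& (i < j)%N, (j < k)%N, (k < l)%N, i == s l & j == s k]]|.

Definition lev j s : nat := #|[set i : 'I_n | (i < j)%N && (j < s i)%N]|.

Lemma levE j s : fixpt s j ->
  lev j s = #|[set l : 'I_n | (j < l)%N && (s l < j)%N]|.
Proof.
move=> /eqP sj; rewrite /lev.
pose A := [set i : 'I_n | (i < j)%N]; pose B := [set i : 'I_n | (s i < j)%N].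
have cardAB : #|A| = #|B|.
  have -> : B = s @^-1: A by apply/setP=> i; rewrite !inE.
  by rewrite card_preimset //; apply: perm_inj.
have neq i : (i == j :> nat) = (s i == j :> nat).
  by rewrite -[in RHS]sj !(inj_eq val_inj) (inj_eq perm_inj).
have -> : [set i : 'I_n | (i < j)%N && (j < s i)%N] = A :\: B.
  apply/setP=> i; rewrite !inE andbC; have := neq i.
  by case: (ltngtP i j) => _; case: (ltngtP (s i) j).
have -> : [set l : 'I_n | (j < l)%N && (s l < j)%N] = B :\: A.
  apply/setP=> i; rewrite !inE; have := neq i.
  by case: (ltngtP i j) => _; case: (ltngtP (s i) j).
by apply/eqP; rewrite -(eqn_add2l #|A :&: B|) cardsID setIC cardsID cardAB.
Qed.

End PermutationStatistics.

Definition Qpoly (R : comNzRingType) (a b c d : nat -> nat -> R) (e : nat -> R)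
    (n : nat) : R :=
  \sum_(s : 'S_n)
    (\prod_(i < n | cval s i) a (ucross i s) (unest i s) *
     \prod_(i < n | cpeak s i) b (lcross i s) (lnest i s) *
     \prod_(i < n | cdfall s i) c (lcross i s) (lnest i s) *
     \prod_(i < n | cdrise s i) d (ucross i s) (unest i s) *
     \prod_(i < n | fixpt s i) e (lev i s)).

(* star_pred x n is x*_{n-1} = \sum_{l=0}^{n-1} x_{l,n-1-l}; in particular    *)
(* x*_{-1} = star_pred x 0 = 0.                                               *)
Definition star_pred (R : comNzRingType) (x : nat -> nat -> R) (n : nat) : R :=
  \sum_(l < n) x l (n - 1 - l)%N.

(* Main.v *)
Require Import Defs.
From mathcomp Require Import all_boot all_algebra all_fingroup.
From mathcomp Require Import ring zify.

Set Implicit Arguments.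
Unset Strict Implicit.
Unset Printing Implicit Defensive.

Import GRing.Theory.
Local Open Scope ring_scope.

(** A permutation is cut into its cycle types, its excedances and its
    anti-excedances. The cycle types form a word; reading a cycle valley as a
    rise, a cycle peak as a fall and the three other types as level steps, this
    word is a Motzkin path ([balanced_word]). Once the word is fixed, the
    permutation amounts to an arbitrary pair of matchings: one sends the
    positions of the excedances to their values, always upwards, the other does
    the same downwards for the anti-excedances ([sum_perm_word]). The crossing
    and nesting numbers in the weight see only one of the two matchings, so the
    sum over the permutations with a given word is a product of two sums over
    matchings.

    Each of these sums is a product over positions ([sum_matchings]). For the
    upward matching, match the largest position first. If m values lie above
    it, choosing the (l+1)-st smallest one gives crossing number l and nesting
    number m-1-l, whatever is done with the smaller positions, and the remaining
    problem has the same form. So the position contributes the star sum of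
    level m-1. The downward matching is the mirror image. The number m is the
    height of the path at that position (one more at a rise), as is shown in
    [slots_up] and [slots_lo]; a fixed point j contributes e at the height,
    because lev(j) counts the excedances that pass over j ([lev_height]).

    Hence Q_n is the weighted sum of all Motzkin paths of length n
    ([Qpoly_words], [sum_words]). By the classical theorem of Flajolet, the
    generating function of such paths is the J-fraction: decomposing a path at
    its first return to the starting level gives the functional equation that
    defines the convergents ([paths_return], [jconvergent_paths]). *)

(** * Motzkin paths and J-fractions *)

Section MotzkinPaths.
Variable R : comNzRingType.
Variables u dn g : nat -> R.

(** The weighted sum of the Motzkin paths of length [n] from height [m + h] to
    height [m] that stay at height at least [m]. *)
Fixpoint paths (m n h : nat) : R :=
  if n is n'.+1 then
    u (m + h)%N * paths m n' h.+1 + g (m + h)%N * paths m n' h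
      + (if h is h'.+1 then dn (m + h)%N * paths m n' h' else 0)
  else (h == 0%N)%:R.

(** A path from [m + h + 1] to [m] is cut at its first arrival at [m]: before
    the step that leads there it stays at height at least [m + 1]. *)
Lemma paths_first_passage m n h :
  paths m n h.+1 =
  \sum_(i < n) paths m.+1 i h * (dn m.+1 * paths m (n - i.+1) 0).
Proof.
elim: n h => [|n IHn] h; first by rewrite big_ord0.
have shift k : \sum_(i < n) paths m.+1 i k * (dn m.+1 * paths m (n.+1 - i.+2) 0)
    = paths m n k.+1.
  by rewrite IHn; apply: eq_bigr => i _; rewrite subSS.
rewrite big_ord_recl [LHS]/= subn1 /=.
(* The term of index 0 is the path that falls to [m] at once. In all the other
   terms the first step is split off the initial part. *)
transitivity ((h == 0%N)%:R * (dn m.+1 * paths m n 0)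
   + (u (m + h.+1)%N * paths m n h.+2 + g (m + h.+1)%N * paths m n h.+1
   + (if h is h'.+1 then dn (m + h.+1)%N * paths m n h'.+1 else 0))).
  case: h => [|h] /=; last by rewrite mul0r add0r.
  by rewrite mul1r addr0 addrC addn1.
congr (_ + _); rewrite -!shift !mulr_sumr.
case: h => [|h].
  rewrite addr0 -big_split; apply: eq_bigr => i _ /=.
  by rewrite addSnnS /bump /= !add1n; ring.
rewrite -shift mulr_sumr -!big_split; apply: eq_bigr => i _ /=.
by rewrite addSnnS /bump /= !add1n; ring.
Qed.

(** The coefficientwise form of J_m = 1 + g_m t J_m + u_m dn_(m+1) t^2 J_(m+1) J_m,
    where J_m is the series of the paths from [m] to [m]. *)
Lemma paths_return m n :
  paths m n.+1 0 = g m * paths m n 0 +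
    \sum_(i < n) (u m * dn m.+1) * paths m.+1 i 0 * paths m (n - i.+1) 0.
Proof.
rewrite /= addr0 addn0 addrC paths_first_passage mulr_sumr; congr (_ + _).
by apply: eq_bigr => i _; ring.
Qed.

Lemma fps_monom2_mul (x : R) f n :
  fps_mul (fps_monom x 2) f n.+2 = x * f n.
Proof.
rewrite /fps_mul !big_ord_recl /fps_monom /= /bump /= !mul0r !add0r.
rewrite subSS subSS subn0 big1 ?addr0 // => i _.
by rewrite mul0r.
Qed.

Lemma fps_monom2_mul_small (x : R) f n :
  (n < 2)%N -> fps_mul (fps_monom x 2) f n = 0.
Proof.
move=> n2; rewrite /fps_mul big1 // => i _; rewrite /fps_monom.
by rewrite ifN ?mul0r //; have := ltn_ord i; lia.
Qed.

(** An inverse known modulo t^N is already determined modulo t^N, which is what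
    a comparison with a truncated continued fraction requires. *)
Lemma fps_inv_unique (f h : nat -> R) N :
  f 0%N = 1 ->
  (forall n, (n < N)%N -> fps_mul f h n = fps_one R n) ->
  forall n, (n < N)%N -> fps_inv f n = h n.
Proof.
move=> f0 fh n; elim/ltn_ind: n => n IHn ltnN.
have := fh n ltnN; rewrite -(fps_invP f0 n) /fps_mul !big_ord_recl f0 !mul1r !subn0.
have -> : \sum_(i < n) f (lift ord0 i) * h (n - lift ord0 i)%N =
          \sum_(i < n) f (lift ord0 i) * fps_inv f (n - lift ord0 i)%N.
  apply: eq_bigr => i _; rewrite IHn //= /bump /=; have := ltn_ord i; lia.
by move/addIr.
Qed.

(** A path of length [n] climbs fewer than [n.+1] levels, so that [k > n] levels
    of the continued fraction are enough to compute its coefficient [n]. *)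
Lemma jconvergent_paths (beta : nat -> R) k m n :
  (forall m, beta m.+1 = u m * dn m.+1) -> (n < k)%N ->
  jconvergent g beta k m n = paths m n 0.
Proof.
move=> betaE; elim: k m n => [//|k IHk] m n ltnk.
(* [f] is the denominator: 1 - g_m t - beta_(m+1) t^2 (convergent at [m + 1]). *)
set f := fps_sub (fps_sub (fps_one R) (fps_monom (g m) 1))
  (fps_mul (fps_monom (beta m.+1) 2) (jconvergent g beta k m.+1)).
have f0 : f 0%N = 1.
  by rewrite /f /fps_sub fps_monom2_mul_small // /fps_one /fps_monom /= !subr0.
have f1 : f 1%N = - g m.
  by rewrite /f /fps_sub fps_monom2_mul_small // /fps_one /fps_monom /= subr0 sub0r.
have f2 i : (i < k)%N -> f i.+2 = - (beta m.+1 * paths m.+1 i 0).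
  move=> ltik; rewrite /f /fps_sub fps_monom2_mul IHk //.
  by rewrite /fps_one /fps_monom /= subr0 sub0r.
apply: (@fps_inv_unique f (fun n => paths m n 0) k.+1 f0 _ n ltnk) => -[|p] ltpk.
  by rewrite /fps_mul big_ord1 f0 mul1r.
rewrite /fps_mul big_ord_recl big_ord_recl f0 f1 mul1r subn0 paths_return.
rewrite [RHS]/= /bump /= subn1 /=.
suff -> : \sum_(i < p) f (1 + (1 + i))%N * paths m (p.+1 - (1 + (1 + i))) 0 =
  - \sum_(i < p) (u m * dn m.+1) * paths m.+1 i 0 * paths m (p - i.+1) 0.
  by rewrite /fps_one /fps_monom /=; ring.
rewrite -sumrN; apply: eq_bigr => i _; rewrite !add1n subSS f2 ?betaE; first by ring.
by have := ltn_ord i; lia.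
Qed.

End MotzkinPaths.

(** * Matchings with crossings and nestings *)

(** Matchings on a finite type ordered by an injective rank. Reversing the rank
    exchanges excedances with anti-excedances, so both are covered at once. *)
Section Matchings.
Variables (R : comNzRingType) (T : finType) (rk : T -> nat).
Hypothesis rk_inj : injective rk.
Implicit Types (O C : {set T}) (f : {ffun T -> T}) (i j v : T).

Local Notation "i ≺ j" := (rk i < rk j)%N (at level 70).

(** The bijections from [O] to [C] that increase the rank, extended by the
    identity outside [O] so that each is a single function on [T]. *)
Definition matching O C f :=
  [&& [forall i in O, i ≺ f i], f @: O == C & [forall i in ~: O, f i == i]].

Definition cross O (f : T -> T) j : nat :=
  #|[set i in O | [&& i ≺ j, j ≺ f i & f i ≺ f j]]|.

Definition nest O (f : T -> T) j : nat := #|[set i in O | (i ≺ j) && (f j ≺ f i)]|.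

(** The values above [j] that are left when the positions above [j] have been
    matched. *)
Definition slots O C j : nat :=
  (#|[set v in C | j ≺ v]| - #|[set i in O | j ≺ i]|)%N.

Lemma ex_last O j0 : j0 \in O ->
  exists2 j, j \in O & forall i, i \in O -> i != j -> i ≺ j.
Proof.
move=> Oj0; case: (arg_maxnP rk Oj0) => j Oj jmax; exists j => // i Oi nij.
by rewrite ltn_neqAle (inj_eq rk_inj) nij; apply: jmax.
Qed.

(** In increasing order and counting from 0, the element of index l in [D] has
    l elements below it and #|D| - 1 - l above it. *)
Lemma sum_by_position (x : nat -> nat -> R) (D : {set T}) :
  \sum_(v in D) x #|[set c in D | c ≺ v]| #|[set c in D | v ≺ c]| =
  star_pred x #|D|.
Proof.
move En: #|D| => n; elim: n x D En => [|n IHn] x D En.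
  by rewrite (cards0_eq En) big_set0 /star_pred big_ord0.
have /card_gt0P[m0 /ex_last[m Dm mmax]] : (0 < #|D|)%N by rewrite En.
have cDm : #|D :\ m| = n by have := cardsD1 m D; rewrite Dm En => -[].
rewrite (bigD1 m) //= /star_pred big_ord_recr /= addrC subn1 subnn; congr (_ + _).
  (* Without its last element [m], each element of [D] has one fewer above. *)
  pose x' k l := x k l.+1.
  transitivity (\sum_(v in D :\ m)
     x' #|[set c in D :\ m | c ≺ v]| #|[set c in D :\ m | v ≺ c]|).
    apply: eq_big => [v|v /andP[Dv vm]]; first by rewrite in_setD1 andbC.
    have ltvm := mmax v Dv vm; congr (x _ _).
      apply: eq_card => c; rewrite !inE; case: eqP => [->|//] /=.
      by rewrite ltnNge (ltnW ltvm) andbF.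
    rewrite (cardsD1 m) !inE Dm ltvm; congr (_.+1).
    by apply: eq_card => c; rewrite !inE andbA.
  rewrite IHn //; apply: eq_bigr => l _; rewrite /x'; congr (x _ _).
  by have := ltn_ord l; lia.
congr (x _ _).
  rewrite -cDm; apply: eq_card => c; rewrite !inE andbC.
  have [->|ncm] := eqVneq c m; first by rewrite ltnn.
  by case Dc: (c \in D); rewrite ?andbF // mmax.
apply/eqP; rewrite cards_eq0; apply/eqP/setP => c; rewrite !inE.
apply/andP => -[Dc]; have [->|ncm] := eqVneq c m; first by rewrite ltnn.
by rewrite ltnNge ltnW // mmax.
Qed.

Lemma matchingP O C f :
  reflect [/\ forall i, i \in O -> i ≺ f i, f @: O = C
            & forall i, i \notin O -> f i = i] (matching O C f).
Proof.
apply: (iffP and3P) => [[/forall_inP h1 /eqP h2 /forall_inP h3]|[h1 h2 h3]].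
  by split=> // i iO; apply/eqP/h3; rewrite inE.
split; [exact/forall_inP|exact/eqP|].
by apply/forall_inP=> i; rewrite inE => /h3/eqP.
Qed.

Lemma matching_inj O C f : #|O| = #|C| -> matching O C f -> {in O &, injective f}.
Proof. by move=> cOC /matchingP[_ fO _]; apply/imset_injP; rewrite fO cOC. Qed.

Definition reassign f j v : {ffun T -> T} := [ffun i => if i == j then v else f i].

(** Matching [j] with [v] leaves the same problem on [O :\ j] and [C :\ v]. *)
Lemma matching_reassign O C f j v : j \in O -> v \in C -> j ≺ v ->
  f j = j -> matching O C (reassign f j v) && (#|O| == #|C|) =
  matching (O :\ j) (C :\ v) f && (#|O| == #|C|).
Proof.
move=> Oj Cv jv fj; have [cOC|_] := eqP; last by rewrite !andbF.
rewrite !andbT; apply/idP/idP => mf.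
  have finj := matching_inj cOC mf; case/matchingP: mf => h1 h2 h3.
  have E i : i != j -> reassign f j v i = f i by move=> nij; rewrite ffunE (negPf nij).
  have Ej : reassign f j v j = v by rewrite ffunE eqxx.
  apply/matchingP; split.
  - by move=> i; rewrite !inE => /andP[nij Oi]; rewrite -E // h1.
  - apply/setP=> w; rewrite !inE; apply/imsetP/andP.
      case=> i; rewrite !inE => /andP[nij Oi] ->; split.
        by apply: contra (nij) => /eqP fiv; apply/eqP/finj; rewrite // Ej E.
      by rewrite -h2 -E // imset_f.
    rewrite -h2 => -[nwv /imsetP[i Oi ew]].
    have nij : i != j by apply: contra nwv => /eqP ij; rewrite ew ij Ej.
    by exists i; rewrite ?inE ?nij // ew E.
  - move=> i; rewrite !inE negb_and negbK => /orP[/eqP->//|Oi].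
    have nij : i != j by apply: contraNneq Oi => ->.
    by rewrite -E // h3.
case/matchingP: mf => h1 h2 h3; apply/matchingP; split.
- move=> i Oi; rewrite ffunE; case: eqP => [->//|/eqP nij].
  by apply: h1; rewrite !inE nij.
- rewrite -(setD1K Oj) imsetU1 ffunE eqxx -[RHS](setD1K Cv) -h2; congr (_ |: _).
  by apply: eq_in_imset => i; rewrite !inE ffunE => /andP[/negPf->].
- move=> i Oi; rewrite ffunE; case: eqP => [ij|/eqP nij]; first by rewrite ij Oj in Oi.
  by apply: h3; rewrite !inE (negPf Oi) andbF.
Qed.

Lemma card_setD1_sub (A : {set T}) x (P : pred T) : x \in A -> P x ->
  #|[set c in A | P c]| = #|[set c in A :\ x | P c]|.+1.
Proof.
move=> Ax Px; rewrite (cardsD1 x) inE Ax Px add1n; congr _.+1.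
by apply: eq_card => c; rewrite !inE andbA.
Qed.

(** Below the last position [j], matching [j] removes one position and one value
    that are both counted in [slots]. *)
Lemma slotsD1 O C i j v : j \in O -> v \in C -> i ≺ j -> j ≺ v ->
  slots (O :\ j) (C :\ v) i = slots O C i.
Proof.
move=> Oj Cv ij jv; rewrite /slots (@card_setD1_sub C v (fun c => i ≺ c)) //.
  by rewrite (@card_setD1_sub O j (fun c => i ≺ c)) // subSS.
exact: ltn_trans jv.
Qed.

(** Matching the last position [j] first makes the labels independent. As all
    other positions lie below [j], the values above [j] all belong to positions
    below [j]; hence the choice of the value of [j] among them decides the
    crossings and nestings of [j], and those of the other positions do not
    involve [j]. *)
Lemma sum_matchings (X : T -> nat -> nat -> R) O C : #|O| = #|C| ->
  \sum_(f | matching O C f) \prod_(j in O) X j (cross O f j) (nest O f j) =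
  \prod_(j in O) star_pred (X j) (slots O C j).
Proof.
move En: #|O| => n; elim: n O C En => [|n IHn] O C En cC.
  have O0 := cards0_eq En; have C0 : C = set0 by apply: cards0_eq.
  subst O C; rewrite big_set0 (bigD1 [ffun i => i]) /=; last first.
    apply/matchingP; split=> [i|| i _]; rewrite ?inE ?ffunE //.
    by rewrite imset0.
  rewrite big_set0 big1 ?addr0 // => f /andP[/matchingP[_ _ h] /eqP[]].
  by apply/ffunP=> i; rewrite ffunE h ?inE.
have cOC : #|O| = #|C| by rewrite En.
have /card_gt0P[j0 /ex_last[j Oj jmax]] : (0 < #|O|)%N by rewrite En.
have cOj : #|O :\ j| = n by have := cardsD1 j O; rewrite Oj En => -[].
pose D := [set c in C | j ≺ c].
have slotj : slots O C j = #|D|.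
  rewrite /slots (_ : [set i in O | j ≺ i] = set0) ?cards0 ?subn0 //.
  apply/setP=> i; rewrite !inE; apply/andP=> -[Oi].
  have [->|nij] := eqVneq i j; first by rewrite ltnn.
  by rewrite ltnNge ltnW // jmax.
rewrite (bigD1 j) //= slotj -sum_by_position mulr_suml.
rewrite (partition_big (fun f : {ffun T -> T} => f j) (mem D)) /=; last first.
  by move=> f /matchingP[h1 h2 _]; rewrite !inE h1 // -h2 imset_f.
apply: eq_bigr => v; rewrite inE => /andP[Cv jv].
have cCv : n = #|C :\ v| by have := cardsD1 v C; rewrite Cv -cC => -[].
rewrite (reindex_onto (fun f => reassign f j v) (fun f => reassign f j j)) /=; last first.
  move=> f /andP[_ /eqP fj]; apply/ffunP=> i; rewrite !ffunE.
  by case: eqP => [->|//].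
have -> : \prod_(i in O | i != j) star_pred (X i) (slots O C i) =
          \prod_(i in O :\ j) star_pred (X i) (slots (O :\ j) (C :\ v) i).
  apply: eq_big => [i|i /andP[Oi nij]]; first by rewrite in_setD1 andbC.
  by rewrite slotsD1 // jmax.
rewrite -IHn // mulr_sumr; apply: eq_big => f.
  rewrite ffunE eqxx eqxx andbT.
  have [/eqP uf|] := boolP (reassign (reassign f j v) j j == f).
    have fj : f j = j by rewrite -uf ffunE eqxx.
    have := matching_reassign Oj Cv jv fj.
    by rewrite cOC eqxx !andbT.
  rewrite andbF => /eqP nuf; apply/esym/negP => /matchingP[_ _ h].
  apply: nuf; apply/ffunP=> i; rewrite !ffunE.
  by case: eqP => [->|//]; rewrite h ?inE ?eqxx.
case/andP=> /andP[mf _] /eqP uf.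
have finj := matching_inj cOC mf; case/matchingP: (mf) => h1 h2 h3.
have E i : i != j -> reassign f j v i = f i by move=> nij; rewrite ffunE (negPf nij).
have Ej : reassign f j v j = v by rewrite ffunE eqxx.
(* Counting positions by a property of their value is counting values. *)
have cardO (P : pred T) :
    #|[set i in O | P (reassign f j v i)]| = #|[set c in C | P c]|.
  rewrite -(card_in_imset (f := reassign f j v)); last first.
    by move=> x y; rewrite !inE => /andP[? _] /andP[? _]; apply: finj.
  apply: eq_card => c; rewrite inE -h2; apply/imsetP/andP.
    by case=> i; rewrite inE => /andP[Oi Pi] ->; rewrite imset_f.
  by case=> /imsetP[i Oi ->] Pi; exists i; rewrite // inE Oi.
rewrite (bigD1 j) //=; congr (_ * _).
  congr (X j _ _).
    transitivity #|[set i in O | (j ≺ reassign f j v i) && (reassign f j v i ≺ v)]|.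
      apply: eq_card => i; rewrite !inE Ej.
      have [->|nij] := eqVneq i j; first by rewrite Ej !ltnn !andbF.
      by case Oi: (i \in O); rewrite //= jmax.
    rewrite (cardO (fun w => (j ≺ w) && (w ≺ v))).
    by apply: eq_card => c; rewrite !inE andbA.
  transitivity #|[set i in O | v ≺ reassign f j v i]|.
    apply: eq_card => i; rewrite !inE Ej.
    have [->|nij] := eqVneq i j; first by rewrite Ej !ltnn !andbF.
    by case Oi: (i \in O); rewrite //= jmax.
  rewrite (cardO (fun w => v ≺ w)); apply: eq_card => c; rewrite !inE.
  case Cc: (c \in C) => //=; apply/idP/andP => [vc|[]//]; split=> //.
  exact: ltn_trans vc.
apply: eq_big => [i|i /andP[Oi nij]]; first by rewrite in_setD1 andbC.
have aux k : k ≺ i -> k != j.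
  by apply: contraTneq => ->; rewrite -leqNgt ltnW // jmax.
congr (X i _ _); apply: eq_card => k; rewrite !inE (E i nij).
  case ki: (k ≺ i); last by rewrite !andbF.
  by rewrite (E k (aux k ki)) (aux k ki).
case ki: (k ≺ i); last by rewrite !andbF.
by rewrite (E k (aux k ki)) (aux k ki).
Qed.

End Matchings.

(** * Words of cycle types *)

(** The cycle type of an index: [None] for a fixed point; otherwise the first
    boolean tells whether the index is the position of an excedance, the second
    whether it is the value of one. *)
Notation step := (option (bool * bool)).
Notation peak := (Some (false, true)).
Notation valley := (Some (true, false)).

Section Words.
Variable R : comNzRingType.
Variables A B C D E : nat -> R.

(** The height of a path is given as the difference of its numbers [v] of rises
    and [p] of falls so far. The subtraction is truncated, but a path that goes
    below 0 has a fall from height 0, whose weight [B 0] will be 0. *)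
Definition step_weight (x : step) (v p : nat) : R :=
  match x with
  | None => E (v - p)
  | valley => A (v.+1 - p)
  | peak => B (v - p)
  | Some (true, true) => D (v - p)
  | Some (false, false) => C (v - p)
  end.

Definition word_weight n (w : n.-tuple step) v p : R :=
  \prod_(i < n) step_weight (tnth w i)
    (v + count_mem valley (take i w))%N (p + count_mem peak (take i w))%N.

Definition balanced v p (w : seq step) :=
  (v + count_mem valley w == p + count_mem peak w)%N.

Lemma sum_tuple_cons (T : finType) n (F : n.+1.-tuple T -> R) :
  \sum_w F w = \sum_x \sum_(w : n.-tuple T) F [tuple of x :: w].
Proof.
rewrite pair_big /= (reindex (fun q : T * n.-tuple T => [tuple of q.1 :: q.2])) //.
exists (fun w => (thead w, [tuple of behead w])) => [[x w] _|w _] /=.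
  by rewrite theadE; congr pair; apply: val_inj.
by apply: val_inj; rewrite /= [in RHS](tuple_eta w).
Qed.

Lemma big_step (F : step -> R) :
  \sum_x F x = F None + F valley + F peak
    + F (Some (true, true)) + F (Some (false, false)).
Proof.
rewrite (bigD1 None) // (bigD1 valley) //= (bigD1 peak) //=.
rewrite (bigD1 (Some (true, true))) //=.
rewrite (bigD1 (Some (false, false))) //= big1 ?addr0 ?addrA //.
by case=> [[[] []]|].
Qed.

Lemma word_weight_cons n x (w : n.-tuple step) v p :
  word_weight [tuple of x :: w] v p =
  step_weight x v p * word_weight w (v + (x == valley))%N (p + (x == peak))%N.
Proof.
rewrite /word_weight big_ord_recl tnth0 /= !addn0; congr (_ * _).
by apply: eq_bigr => i _; rewrite tnthS /= !addnA.
Qed.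

(** Splitting off the first letter of a word is the recursion for paths. *)
Lemma sum_words n v p : B 0 = 0 -> (p <= v)%N ->
  \sum_(w : n.-tuple step | balanced v p w) word_weight w v p =
  paths (fun h => A h.+1) B (fun h => C h + D h + E h) 0 n (v - p).
Proof.
move=> B0; elim: n v p => [|n IHn] v p lepv.
  rewrite big_mkcond (big_pred1 [tuple]) /= => [|w]; last first.
    by apply/esym/eqP; rewrite [w]tuple0.
  rewrite /balanced /= !addn0 /word_weight big_ord0 subn_eq0.
  have -> : (v <= p)%N = (v == p) by lia.
  by case: eqP.
rewrite big_mkcond sum_tuple_cons.
have stepE x :
    \sum_(w : n.-tuple step) (if balanced v p [tuple of x :: w]
        then word_weight [tuple of x :: w] v p else 0) =
    step_weight x v p *
    \sum_(w : n.-tuple step | balanced (v + (x == valley))%N (p + (x == peak))%N w)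
       word_weight w (v + (x == valley))%N (p + (x == peak))%N.
  rewrite [in RHS]big_mkcond mulr_sumr; apply: eq_bigr => w _.
  by rewrite word_weight_cons /balanced /= !addnA; case: ifP; rewrite ?mulr0.
rewrite (eq_bigr _ (fun x _ => stepE x)) big_step /= !addn0 !addn1 !add0n.
have [ltpv|eqpv] : (p < v)%N \/ p = v by lia.
  by rewrite !IHn ?ltpv ?(leqW lepv) // subSn // -(subnSK ltpv); ring.
by rewrite eqpv !(IHn v v) // (IHn v.+1 v) // subSn // subnn B0; ring.
Qed.

End Words.

(** * Heights, and permutations as pairs of matchings *)

Definition up_pos (x : step) := if x is Some (true, _) then true else false.
Definition lo_pos (x : step) := if x is Some (false, _) then true else false.
Definition up_val (x : step) := if x is Some (_, true) then true else false.
Definition lo_val (x : step) := if x is Some (_, false) then true else false.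

Lemma valleyE x : (x == valley) = up_pos x && lo_val x.
Proof. by case: x => [[[] []]|]. Qed.

Lemma peakE x : (x == peak) = lo_pos x && up_val x.
Proof. by case: x => [[[] []]|]. Qed.

Section Heights.
Variable n : nat.
Implicit Types (w : n.-tuple step) (i j : 'I_n).

Definition places (P : pred step) w : {set 'I_n} := [set i | P (tnth w i)].

(** The reversed order: for it, an anti-excedance goes upwards. *)
Definition corank (i : 'I_n) : nat := (n - i)%N.

Lemma corank_lt i j : (corank i < corank j)%N = (j < i)%N.
Proof. by rewrite /corank; have := ltn_ord i; have := ltn_ord j; lia. Qed.

Lemma corank_inj : injective corank.
Proof.
move=> i j; rewrite /corank => ij; apply: val_inj => /=.
by have := ltn_ord i; have := ltn_ord j; lia.
Qed.

Lemma cards_sum (P : pred 'I_n) : #|[set j | P j]| = (\sum_j P j)%N.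
Proof. by rewrite cardsE -sum1_card big_mkcond. Qed.

Lemma sum_at i (P : pred 'I_n) : (\sum_j ((j == i) && P j))%N = P i.
Proof.
by rewrite (bigD1 i) //= eqxx big1 ?addn0 // => j /negPf->.
Qed.

End Heights.

Lemma count_take (T : Type) (a : pred T) n (w : n.-tuple T) k :
  count a (take k w) = (\sum_(j < n) ((j < k) && a (tnth w j)))%N.
Proof.
elim: n w k => [|n IHn] w k; first by rewrite big_ord0 tuple0.
case/tupleP: w => x w; case: k => [|k]; first by rewrite take0 big1.
rewrite big_ord_recl tnth0 /= IHn; congr (_ + _)%N.
by apply: eq_bigr => j _; rewrite tnthS.
Qed.

Lemma count_tuple (T : Type) (a : pred T) n (w : n.-tuple T) :
  count a w = (\sum_(j < n) a (tnth w j))%N.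
Proof.
rewrite -{1}[tval w](@take_oversize _ n) ?size_tuple // count_take.
by apply: eq_bigr => j _; rewrite ltn_ord.
Qed.

(** Equalities of truncated differences are proved below in this form, where both
    sides are sums over all indices that can be compared term by term. *)
Lemma subn_cross (m1 m2 m3 m4 : nat) :
  (m1 + m4 = m2 + m3 -> m1 - m2 = m3 - m4)%N.
Proof. lia. Qed.

Section Slots.
Variables (n : nat) (w : n.-tuple step).
Hypothesis bal_w : balanced 0 0 w.
Implicit Types (i j : 'I_n).
Local Notation v i := (count_mem valley (take i w)).
Local Notation p i := (count_mem peak (take i w)).
Local Notation O := (places up_pos w).
Local Notation C := (places up_val w).
Local Notation O' := (places lo_pos w).
Local Notation C' := (places lo_val w).

Lemma balE : (\sum_j (tnth w j == valley) = \sum_j (tnth w j == peak))%N.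
Proof. by have /eqP := bal_w; rewrite !add0n !count_tuple. Qed.

Lemma card_up : #|O| = #|C|.
Proof.
rewrite !cards_sum; apply: (@addIn (\sum_j (tnth w j == peak))%N).
rewrite -[in RHS]balE -!big_split; apply: eq_bigr => j _.
by case: (tnth w j) => [[[] []]|].
Qed.

Lemma card_lo : #|O'| = #|C'|.
Proof.
rewrite !cards_sum; apply: (@addIn (\sum_j (tnth w j == valley))%N).
rewrite [in RHS]balE -!big_split; apply: eq_bigr => j _.
by case: (tnth w j) => [[[] []]|].
Qed.

(** The upward slots at [i] are determined by the letters after [i]. Indices that
    are both position and value cancel, so this is the number of peaks minus the
    number of valleys after [i], which by balance is the height just after
    letter [i]. *)
Lemma slots_up i :
  slots val O C i =
  (v i + (tnth w i == valley) - (p i + (tnth w i == peak)))%N.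
Proof.
rewrite /slots !cards_sum !count_take -(sum_at i (fun j => tnth w j == valley)).
rewrite -(sum_at i (fun j => tnth w j == peak)).
have H : (\sum_(j < n) ((j \in C) && (i < j)%N)
    + (\sum_(j < n) ((j < i)%N && (tnth w j == peak))
      + \sum_(j < n) ((j == i) && (tnth w j == peak)))
    + \sum_(j < n) (tnth w j == valley) =
   \sum_(j < n) ((j \in O) && (i < j)%N)
    + (\sum_(j < n) ((j < i)%N && (tnth w j == valley))
      + \sum_(j < n) ((j == i) && (tnth w j == valley)))
    + \sum_(j < n) (tnth w j == peak))%N; last first.
  by move: H; rewrite balE /= => /addIn; apply: subn_cross.
rewrite -!big_split; apply: eq_bigr => j _; rewrite !inE -val_eqE /=.
by case: (tnth w j) => [[[] []]|]; case: ltngtP.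
Qed.

(** In the reversed order the slots at [i] depend on the letters before [i], and
    give the height just before letter [i] directly. *)
Lemma slots_lo i :
  slots (@corank n) O' C' i = (v i - p i)%N.
Proof.
rewrite /slots !cards_sum !count_take.
suff : (\sum_(j < n) ((j \in C') && (corank i < corank j)%N) + 
   \sum_(j < n) ((j < i)%N && (tnth w j == peak)) = 
   \sum_(j < n) ((j \in O') && (corank i < corank j)%N) + 
   \sum_(j < n) ((j < i)%N && (tnth w j == valley)))%N by apply: subn_cross.
rewrite -!big_split; apply: eq_bigr => j _; rewrite !inE corank_lt /=.
by case: (tnth w j) => [[[] []]|]; case: ltngtP.
Qed.

End Slots.

Section Permutations.
Variable n : nat.
Implicit Types (s : 'S_n) (i : 'I_n) (w : n.-tuple step).
Implicit Types (f g : {ffun 'I_n -> 'I_n}).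

Definition step_of s i : step :=
  if s i == i then None else Some ((i < s i)%N, ((s^-1)%g i < i)%N).

Definition word s : n.-tuple step := [tuple step_of s i | i < n].

Definition exc s : {ffun 'I_n -> 'I_n} :=
  [ffun i : 'I_n => if (i < s i)%N then s i else i].
Definition antiexc s : {ffun 'I_n -> 'I_n} :=
  [ffun i : 'I_n => if (s i < i)%N then s i else i].

Variant step_of_spec s i : step -> Type :=
| StepFix of s i = i & (s^-1)%g i = i : step_of_spec s i None
| StepDrise of (i < s i)%N & ((s^-1)%g i < i)%N : step_of_spec s i (Some (true, true))
| StepValley of (i < s i)%N & (i < (s^-1)%g i)%N : step_of_spec s i valley
| StepPeak of (s i < i)%N & ((s^-1)%g i < i)%N : step_of_spec s i peak
| StepDfall of (s i < i)%N & (i < (s^-1)%g i)%N : step_of_spec s i (Some (false, false)).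

Lemma step_ofP s i : step_of_spec s i (step_of s i).
Proof.
rewrite /step_of; have [si|nsi] := eqVneq (s i) i.
  by constructor; rewrite // -[in LHS]si permK.
have : (s^-1)%g i != i.
  by apply: contra nsi => /eqP si; rewrite -[in X in s X]si permKV.
move: nsi; rewrite -!val_eqE /=.
by do 2!case: ltngtP => //= ? _; constructor.
Qed.

Lemma step_ofE s i :
  (up_pos (step_of s i) = (i < s i)%N) * (lo_pos (step_of s i) = (s i < i)%N) *
  (up_val (step_of s i) = ((s^-1)%g i < i)%N) *
  (lo_val (step_of s i) = (i < (s^-1)%g i)%N).
Proof.
case: step_ofP => [-> ->|p q|p q|p q|p q]; rewrite ?ltnn //= ?p ?q.
all: by do !split=> //; apply/esym/negbTE; rewrite -leqNgt ltnW.
Qed.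

Lemma exc_antiexc_inj s1 s2 :
  exc s1 = exc s2 -> antiexc s1 = antiexc s2 -> s1 = s2.
Proof.
move=> /ffunP e /ffunP a; apply/permP=> i; have := e i; have := a i.
rewrite !ffunE => /(congr1 val) + /(congr1 val).
rewrite !(fun_if val) => ha he; apply: val_inj; move: ha he => /=.
by case: (ltngtP i (s1 i)); case: (ltngtP i (s2 i)) => //; lia.
Qed.

(** The domain of either matching is recovered from it, as the set of the points
    that it moves; so being matchings for [w] forces the word to be [w]. *)
Lemma matching_word s w :
  matching val (places up_pos w) (places up_val w) (exc s) &&
  matching (@corank n) (places lo_pos w) (places lo_val w) (antiexc s) =
  (word s == w).
Proof.
have inC x : (x \in places up_val (word s)) = ((s^-1)%g x < x)%N.
  by rewrite inE tnth_mktuple step_ofE.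
have inC' x : (x \in places lo_val (word s)) = (x < (s^-1)%g x)%N.
  by rewrite inE tnth_mktuple step_ofE.
apply/idP/eqP => [/andP[/matchingP[h1 h2 h3] /matchingP[k1 k2 k3]]|<-].
  have upE i : up_pos (tnth w i) = (i < s i)%N.
    apply/idP/idP => [wi|isi].
      have := h1 i; rewrite inE ffunE => /(_ wi).
      by case: ifP => //=; rewrite ltnn.
    apply: contraTT isi => wi; have := h3 i; rewrite inE ffunE => /(_ wi).
    by case: ltnP => // + si; rewrite si ltnn.
  have loE i : lo_pos (tnth w i) = (s i < i)%N.
    apply/idP/idP => [wi|isi].
      have := k1 i; rewrite inE corank_lt ffunE => /(_ wi).
      by case: ifP => //=; rewrite ltnn.
    apply: contraTT isi => wi; have := k3 i; rewrite inE ffunE => /(_ wi).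
    by case: ltnP => // + si; rewrite si ltnn.
  have valE i : up_val (tnth w i) = ((s^-1)%g i < i)%N.
    have := in_set (fun i => up_val (tnth w i)) i; rewrite -/(places up_val w) => <-.
    rewrite -h2; apply/imsetP/idP => [[k]|lt].
      by rewrite inE upE => kk ->; rewrite ffunE kk permK.
    by exists ((s^-1)%g i); rewrite ?inE ?upE ?ffunE permKV ?lt.
  apply: eq_from_tnth => i; rewrite tnth_mktuple.
  move: (upE i) (loE i) (valE i).
  case: step_ofP => [-> ->|p q|p q|p q|p q]; rewrite ?ltnn ?p ?q //;
    by case: (tnth w i) => [[[] []]|] //= *; lia.
apply/andP; split; apply/matchingP; split.
- by move=> i; rewrite inE tnth_mktuple step_ofE ffunE => isi; rewrite isi.
- apply/setP => x; rewrite inC; apply/imsetP/idP => [[i]|lt].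
    by rewrite inE tnth_mktuple step_ofE ffunE => isi; rewrite isi => ->; rewrite permK.
  by exists ((s^-1)%g x); rewrite ?inE ?tnth_mktuple ?step_ofE ?ffunE permKV ?lt.
- by move=> i; rewrite inE tnth_mktuple step_ofE ffunE => /negbTE->.
- by move=> i; rewrite inE tnth_mktuple step_ofE ffunE corank_lt => isi; rewrite isi.
- apply/setP => x; rewrite inC'; apply/imsetP/idP => [[i]|lt].
    by rewrite inE tnth_mktuple step_ofE ffunE => isi; rewrite isi => ->; rewrite permK.
  by exists ((s^-1)%g x); rewrite ?inE ?tnth_mktuple ?step_ofE ?ffunE permKV ?lt.
- by move=> i; rewrite inE tnth_mktuple step_ofE ffunE => /negbTE->.
Qed.

(** The values of the two matchings and the fixed points cover all indices, so
    gluing gives a surjection from a finite set to itself. *)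
Lemma glue_matchings w f g :
  matching val (places up_pos w) (places up_val w) f ->
  matching (@corank n) (places lo_pos w) (places lo_val w) g ->
  exists s, (exc s, antiexc s) = (f, g).
Proof.
case/matchingP=> h1 h2 h3 /matchingP[k1 k2 k3].
pose F i := if up_pos (tnth w i) then f i else if lo_pos (tnth w i) then g i else i.
have F_onto : F @: setT = setT.
  apply/setP=> x; rewrite inE; apply/imsetP.
  case wx: (tnth w x) => [[b []]|].
  - have : x \in places up_val w by rewrite inE wx.
    rewrite -h2 => /imsetP[i]; rewrite inE => wi ->; exists i => //.
    by rewrite /F wi.
  - have : x \in places lo_val w by rewrite inE wx.
    rewrite -k2 => /imsetP[i]; rewrite inE => wi ->; exists i => //.
    by rewrite /F wi; case: (tnth w i) wi => [[[] []]|].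
  - by exists x; rewrite // /F wx.
have F_inj : injective F.
  have /imset_injP Finj : #|F @: setT| == #|[set: 'I_n]| by rewrite F_onto.
  by move=> x y; apply: Finj; rewrite inE.
exists (perm F_inj); congr pair; apply/ffunP=> i; rewrite ffunE permE /F.
- have := h1 i; have := h3 i; have := k1 i; rewrite !inE corank_lt.
  case: (tnth w i) => [[[] b]|] /= H1 H2 H3.
  + by rewrite H3.
  + by rewrite ltnNge ltnW ?H1 // H2.
  + by rewrite ltnn H2.
- have := h1 i; have := k3 i; have := k1 i; rewrite !inE corank_lt.
  case: (tnth w i) => [[[] b]|] /= H1 H2 H3.
  + by rewrite ltnNge ltnW ?H3 // H2.
  + by rewrite H1.
  + by rewrite ltnn H2.
Qed.

Lemma sum_perm_word (R : comNzRingType) (F G : {ffun 'I_n -> 'I_n} -> R) w :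
  \sum_(s | word s == w) F (exc s) * G (antiexc s) =
  (\sum_(f | matching val (places up_pos w) (places up_val w) f) F f) *
  (\sum_(g | matching (@corank n) (places lo_pos w) (places lo_val w) g) G g).
Proof.
rewrite mulr_suml; under [RHS]eq_bigr do rewrite mulr_sumr.
rewrite pair_big /=.
pose h s := (exc s, antiexc s).
have h_inj : injective h by move=> s1 s2 [] /exc_antiexc_inj.
(* [pick] inverts [h], with a harmless default outside its image. *)
rewrite (reindex_onto h (fun q => odflt 1%g [pick s | h s == q])) /=; last first.
  case=> f g /andP[mf mg]; have [s hs] := glue_matchings mf mg.
  by case: pickP => [t /eqP//|/(_ s)]; rewrite /h hs eqxx.
apply: eq_bigl => s; rewrite matching_word.
case: pickP => [t /eqP/h_inj -> /=|/(_ s)]; last by rewrite eqxx.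
by rewrite eqxx andbT.
Qed.

End Permutations.

(** * The statistics of a permutation in terms of its matchings *)

Section Statistics.
Variable n : nat.
Implicit Types (s : 'S_n) (i j k l : 'I_n).

Lemma card_graph (T S : finType) (h : T -> S) (A : {set T}) (B : {set S}) :
  injective h -> (forall q, q \in B -> exists x, q = h x) ->
  (forall x, (h x \in B) = (x \in A)) -> #|B| = #|A|.
Proof.
move=> h_inj Bh hBA; rewrite -(card_imset A h_inj); apply: eq_card => q.
apply/idP/imsetP => [Bq|[x Ax ->]]; last by rewrite hBA.
by have [x qx] := Bh q Bq; exists x; rewrite // -hBA -qx.
Qed.

(** In the triples counted by the four statistics, two entries are functions of
    the third; being in the domain of the matching is implied by the
    inequalities. *)
Lemma ucross_cross s j : (j < s j)%N ->
  ucross j s = cross val (places up_pos (word s)) (exc s) j.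
Proof.
move=> jsj; apply: (card_graph (h := fun i => (i, s i, s j))).
- by move=> i i' [].
- by case=> -[i k] l; rewrite inE => /and5P[_ _ _ /eqP-> /eqP->]; exists i.
move=> i; rewrite !inE !tnth_mktuple !step_ofE !ffunE jsj !eqxx !andbT.
case: (ltnP i (s i)) => [//|sii]; apply/negbTE/and3P => -[ij jsi _].
by have := ltn_trans ij jsi; rewrite ltnNge sii.
Qed.

Lemma unest_nest s j : (j < s j)%N ->
  unest j s = nest val (places up_pos (word s)) (exc s) j.
Proof.
move=> jsj; apply: (card_graph (h := fun i => (i, s j, s i))).
- by move=> i i' [].
- by case=> -[i k] l; rewrite inE => /and5P[_ _ _ /eqP-> /eqP->]; exists i.
move=> i; rewrite !inE !tnth_mktuple !step_ofE !ffunE jsj !eqxx !andbT /=.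
case: (ltnP i (s i)) => [//|sii]; apply/negbTE/andP => -[ij jsi].
by have := ltn_trans (ltn_trans ij jsj) jsi; rewrite ltnNge sii.
Qed.

Lemma lcross_cross s k : (s k < k)%N ->
  lcross k s = cross (@corank n) (places lo_pos (word s)) (antiexc s) k.
Proof.
move=> skk; apply: (card_graph (h := fun l => (s k, s l, l))).
- by move=> i i' [].
- by case=> -[i j] l; rewrite inE => /and5P[_ _ _ /eqP-> /eqP->]; exists l.
move=> l; rewrite !inE !tnth_mktuple !step_ofE !ffunE skk !eqxx !andbT !corank_lt.
case: (ltnP (s l) l) => [_|sll] /=; first by apply/and3P/and3P => -[].
by apply/negbTE/and3P => -[_ slk kl]; have := ltn_trans slk kl; rewrite ltnNge sll.
Qed.

Lemma lnest_nest s k : (s k < k)%N ->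
  lnest k s = nest (@corank n) (places lo_pos (word s)) (antiexc s) k.
Proof.
move=> skk; apply: (card_graph (h := fun l => (s l, s k, l))).
- by move=> i i' [].
- by case=> -[i j] l; rewrite inE => /and5P[_ _ _ /eqP-> /eqP->]; exists l.
move=> l; rewrite !inE !tnth_mktuple !step_ofE !ffunE skk !eqxx !andbT !corank_lt /=.
case: (ltnP (s l) l) => [_|sll] /=; first by rewrite andbC.
apply/negbTE/andP => -[slk kl].
by have := ltn_trans slk (ltn_trans skk kl); rewrite ltnNge sll.
Qed.

(** At a fixed point, the excedances that pass over it are those that start before
    it minus those that end before it. *)
Lemma lev_height s i : s i = i ->
  lev i s = (count_mem valley (take i (word s)) - count_mem peak (take i (word s)))%N.
Proof.
move=> si; rewrite /lev cards_sum !count_take -[LHS]subn0; apply: subn_cross.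
rewrite add0n.
(* Excedances with both ends before [i], counted by value or by position. *)
have e : (\sum_j (((s^-1)%g j < i)%N && ((s^-1)%g j < j)%N && (j < i)%N) =
          \sum_(j : 'I_n) ((j < i)%N && (j < s j)%N && (s j < i)%N))%N.
  by rewrite (reindex_inj (@perm_inj _ s)); apply: eq_bigr => j _; rewrite permK.
(* Adding the double rises before [i] turns peaks into values of excedances, and
   valleys into positions of excedances. *)
apply/eqP; rewrite -(eqn_add2r (\sum_(j : 'I_n) ((j < i)%N
  && up_pos (tnth (word s) j) && up_val (tnth (word s) j)))%N); apply/eqP.
transitivity (\sum_(j : 'I_n) ((j < i)%N && (i < s j)%N)
  + \sum_(j : 'I_n) ((j < i)%N && (j < s j)%N && (s j < i)%N))%N.
  rewrite -addnA -e -big_split; congr (_ + _)%N; apply: eq_bigr => j _ /=.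
  rewrite !tnth_mktuple /= peakE.
  by case: step_ofP => [_ ->|? ?|? ?|? ?|? ?] /=; lia.
rewrite -!big_split; apply: eq_bigr => j _ /=; rewrite !tnth_mktuple valleyE.
have: (s j == i) = (j == i) by rewrite -[in LHS]si (inj_eq perm_inj).
rewrite -!val_eqE /= => sji.
case: step_ofP => [-> _|? ?|? ?|? ?|? ?] /=; lia.
Qed.

(** Each excedance has one position and one value; double rises are both. *)
Lemma balanced_word s : balanced 0 0 (word s).
Proof.
rewrite /balanced !add0n !count_tuple; apply/eqP.
apply: (@addIn (\sum_j (up_pos (tnth (word s) j) && up_val (tnth (word s) j)))%N).
rewrite -!big_split /=.
transitivity (\sum_(j : 'I_n) (j < s j)%N)%N.
  apply: eq_bigr => j _; rewrite tnth_mktuple ?valleyE ?peakE;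
    by case: step_ofP => [-> _|? ?|? ?|? ?|? ?] /=; lia.
transitivity (\sum_(j : 'I_n) ((s^-1)%g j < j)%N)%N.
  by rewrite [RHS](reindex_inj (@perm_inj _ s)); apply: eq_bigr => j _; rewrite permK.
apply: eq_bigr => j _; rewrite tnth_mktuple ?valleyE ?peakE;
  by case: step_ofP => [_ ->|? ?|? ?|? ?|? ?] /=; lia.
Qed.

Variable R : comNzRingType.
Variables (a b c d : nat -> nat -> R) (e : nat -> R).

Definition up_weight (x : step) := if up_val x then d else a.
Definition lo_weight (x : step) := if up_val x then b else c.

(** The weight of a permutation separates into factors that depend, besides the
    word, on the excedances alone, the anti-excedances alone, and the heights
    of the fixed points. *)
Lemma Qpoly_term s (w := word s) :
  \prod_(i < n | cval s i) a (ucross i s) (unest i s) *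
  \prod_(i < n | cpeak s i) b (lcross i s) (lnest i s) *
  \prod_(i < n | cdfall s i) c (lcross i s) (lnest i s) *
  \prod_(i < n | cdrise s i) d (ucross i s) (unest i s) *
  \prod_(i < n | fixpt s i) e (lev i s) =
  (\prod_(i in places up_pos w) up_weight (tnth w i)
     (cross val (places up_pos w) (exc s) i) (nest val (places up_pos w) (exc s) i)) *
  (\prod_(i in places lo_pos w) lo_weight (tnth w i)
     (cross (@corank n) (places lo_pos w) (antiexc s) i)
     (nest (@corank n) (places lo_pos w) (antiexc s) i)) *
  \prod_(i | tnth w i == None)
     e (count_mem valley (take i w) - count_mem peak (take i w))%N.
Proof.
rewrite (big_mkcond (cval s)) (big_mkcond (cpeak s)) (big_mkcond (cdfall s)).
rewrite (big_mkcond (cdrise s)) (big_mkcond (fixpt s)).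
rewrite (big_mkcond (fun i => i \in places up_pos w)).
rewrite (big_mkcond (fun i => i \in places lo_pos w)).
rewrite (big_mkcond (fun i => tnth w i == None)) -!big_split; apply: eq_bigr => i _ /=.
rewrite !inE /w !tnth_mktuple /cval /cpeak /cdfall /cdrise /fixpt.
case: step_ofP => [si si'|p q|p q|p q|p q] /=; rewrite /up_weight /lo_weight /=.
- by rewrite si si' !ltnn eqxx /= !mul1r lev_height.
- by rewrite p q (ltnNge (s i)) (ltnW p) (ltnNge i ((s^-1)%g i)) (ltnW q)
    /= -val_eqE gtn_eqF // ucross_cross ?unest_nest // !mul1r !mulr1.
- by rewrite p q (ltnNge (s i)) (ltnW p) (ltnNge ((s^-1)%g i) i) (ltnW q)
    /= -val_eqE gtn_eqF // ucross_cross ?unest_nest // ?mul1r !mulr1.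
- by rewrite p q (ltnNge i (s i)) (ltnW p) (ltnNge i ((s^-1)%g i)) (ltnW q)
    /= -val_eqE ltn_eqF // lcross_cross ?lnest_nest // !mul1r !mulr1.
- by rewrite p q (ltnNge i (s i)) (ltnW p) (ltnNge ((s^-1)%g i) i) (ltnW q)
    /= -val_eqE ltn_eqF // lcross_cross ?lnest_nest // !mul1r !mulr1.
Qed.

Lemma Qpoly_words :
  Qpoly a b c d e n = \sum_(w : n.-tuple step | balanced 0 0 w)
    word_weight (star_pred a) (star_pred b) (star_pred c) (star_pred d) e w 0 0.
Proof.
rewrite /Qpoly (partition_big (@word n) (fun w => balanced 0 0 w)) /=; last first.
  by move=> s _; apply: balanced_word.
apply: eq_bigr => w bal_w.
pose F f := \prod_(i in places up_pos w) up_weight (tnth w i)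
  (cross val (places up_pos w) f i) (nest val (places up_pos w) f i).
pose G g := \prod_(i in places lo_pos w) lo_weight (tnth w i)
  (cross (@corank n) (places lo_pos w) g i) (nest (@corank n) (places lo_pos w) g i).
rewrite (eq_bigr (fun s => F (exc s) * G (antiexc s) * \prod_(i | tnth w i == None)
     e (count_mem valley (take i w) - count_mem peak (take i w))%N)); last first.
  by move=> s /eqP ws; rewrite /F /G -ws Qpoly_term.
rewrite -mulr_suml (sum_perm_word F G w).
rewrite (sum_matchings val_inj (fun i => up_weight (tnth w i)) (card_up bal_w)).
rewrite (sum_matchings (@corank_inj n) (fun i => lo_weight (tnth w i)) (card_lo bal_w)).
rewrite (big_mkcond (fun i => i \in places up_pos w)).
rewrite (big_mkcond (fun i => i \in places lo_pos w)).
rewrite (big_mkcond (fun i => tnth w i == None)) -!big_split; apply: eq_bigr => i _ /=.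
rewrite !inE slots_up // slots_lo // /up_weight /lo_weight !add0n.
by case: (tnth w i) => [[[] []]|] /=; rewrite ?addn0 ?addn1 ?mulr1 ?mul1r.
Qed.

End Statistics.

(** * The J-fraction *)

Theorem theorem2p9 (R : comNzRingType) (a b c d : nat -> nat -> R)
    (e : nat -> R) :
  is_Jfraction (Qpoly a b c d e)
    (fun n => star_pred c n + star_pred d n + e n)
    (fun n => star_pred a n * star_pred b n).
Proof.
move=> n; exists n.+1 => k ltnk.
rewrite (@jconvergent_paths _ (fun h => star_pred a h.+1) (star_pred b)) //.
rewrite Qpoly_words sum_words //.
by rewrite /star_pred big_ord0.
Qed.
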